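(* Let $f:2^V\to\mathbb{R}_{\ge0}$ be monotone submodular with $f(\{v\})>0$ for all $v\in V$, let $k\ge1$ and $1\le W'\le W$ be integers, let $\epsilon\in(0,1)$, and let $v_1,v_2,\dots$ be a stream of elements of $V$. Run the algorithm $\mathsf{BidirectionalAlg}$ (described in the context) with sub-window size $W'$ and $\delta=\epsilon$. Then at every time $t$ the returned value is $f(S)$ for a set $S\subseteq A_t$ with $|S|\le k$ and satisfies $f(S)\ge(\tfrac12-\epsilon)\,f_k(A_t)$; i.e., the algorithm is a $(\tfrac12-\epsilon)$-approximation for maximizing $f$ subject to a cardinality constraint $k$ over the sliding window of the last $W$ elements.
   Context: Active window: $A_t=\{v_{\max(1,t-W+1)},\dots,v_t\}$; $f_k(A)=\max_{S\subseteq A,|S|\le k}f(S)$; $f'_S(v)=f(S\cup\{v\})-f(S)$; $\Delta=\max_{v\in V}f(\{v\})$. Algorithm $\mathsf{BidirectionalAlg}$ (parameters $W'$, $\delta$): Sub-window $i\ge1$ consists of times $(i-1)W'+1,\dots,iW'$. For $i\ge1$, $T_i=\{(1+\delta)^jf(\{v_{iW'}\})/(2k): j=0,\dots,m_i\}$ with $m_i=\lfloor\log_{1+\delta}(2k\Delta/f(\{v_{iW'}\}))\rfloor$; $T_0=\{(1+\delta)^jf(\{v_1\})/(2k): j=0,\dots,m_0\}$ with $m_0=\lfloor\log_{1+\delta}(2k\Delta/f(\{v_1\}))\rfloor$, and the family $\mathcal S^0_\tau$ consists of the single set $S^{0,0}_\tau=\emptyset$ for each $\tau\in T_0$. At each time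 $t$: (a) if $t=iW'$ for an integer $i\ge1$, then for each $\tau\in T_i$: set $B\leftarrow\emptyset$, $S^{i,t}_\tau\leftarrow\emptyset$, and for $t'=t,t-1,\dots,t-W'+1$ (backward), if $f'_B(v_{t'})\ge\tau$ and $|B|<k$, add $v_{t'}$ to $B$ and create $S^{i,t'}_\tau\leftarrow$ a copy of $B$; the family $\mathcal S^i_\tau$ is the collection of all sets $S^{i,t'}_\tau$ so created (at most $k+1$ of them). (b) Let $i_t=\max\{0,\lceil(t-W+1)/W'\rceil\}$. For every $i$ with $i_t\le i\le\lceil t/W'\rceil-1$, every $\tau\in T_i$ and every set $S^{i,t'}_\tau\in\mathcal S^i_\tau$: if $f'_{S^{i,t'}_\tau}(v_t)\ge\tau$ and $|S^{i,t'}_\tau|<k$, add $v_t$ to $S^{i,t'}_\tau$. (c) For each $\tau\in T_{i_t}$ let $S^{i_t,t^*}_\tau$ be the set in $\mathcal S^{i_t}_\tau$ with minimum index $t^*$ such that $S^{i_t,t^*}_\tau\subseteq A_t$; return $\max_{\tau\in T_{i_t}}f(S^{i_t,t^*}_\tau)$. *)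

(* Defs.v *)
From HB Require Import structures.
From mathcomp Require Import all_boot all_order all_algebra.
From mathcomp Require Import reals exp.

Set Implicit Arguments.
Unset Strict Implicit.
Unset Printing Implicit Defensive.

Import Order.TTheory GRing.Theory Num.Theory.
Local Open Scope ring_scope.

Section SetFunctions.
Context {R : realType} {V : finType}.
Implicit Types (f : {set V} -> R) (A S T : {set V}) (x : V).

Definition marginal f S x : R := f (x |: S) - f S.

Definition monotone_setfun f : Prop :=
  forall S T, S \subset T -> f S <= f T.

Definition submodular f : Prop :=
  forall S T x, S \subset T -> x \notin T -> marginal f T x <= marginal f S x.

(* The empty set is always admissible, so starting the iterated maximum at
   [f set0] adds nothing. *)
Definition opt f (k : nat) A : R :=
  \big[Num.max/f set0]_(S : {set V} | (S \subset A) && (#|S| <= k)%N) f S.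

(* The start value 0 is harmless: this is used with positive singleton values
   and a nonempty [V]. *)
Definition max_singleton f : R := \big[Num.max/0]_(x : V) f [set x].

End SetFunctions.

Definition ceildiv (a b : nat) : nat := ((a + b.-1) %/ b)%N.

Section Stream.
Context {V : finType}.

(* Times start at 1; [v 0] is never read. *)
Definition active_window (v : nat -> V) (W t : nat) : {set V} :=
  [set:: [seq v s | s <- index_iota (maxn 1 (t.+1 - W)) t.+1]].

End Stream.

Section BidirectionalAlg.
Context {R : realType} {V : finType}.
Context (f : {set V} -> R) (k W W' : nat) (delta : R) (v : nat -> V).

Definition ref_elt (i : nat) : V := if i == 0%N then v 1%N else v (i * W')%N.

(* [Num.truncn] is the floor on nonnegative reals; the quotient of logarithms
   is nonnegative because 2 k Delta >= f {ref_elt i} > 0. *)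
Definition num_thresholds (i : nat) : nat :=
  Num.truncn (ln ((2 * k)%:R * max_singleton f / f [set ref_elt i])
              / ln (1 + delta)).

Definition thresholds (i : nat) : seq R :=
  [seq (1 + delta) ^+ j * f [set ref_elt i] / (2 * k)%:R
     | j <- iota 0 (num_thresholds i).+1].

(* A family maps an index t' to the current content of S^{i,t'}_tau, and to
   [None] if no set with that index has been created. *)
Definition family : Type := nat -> option {set V}.

Definition empty_family : family := fun _ => None.

Definition store (F : family) (s : nat) (S : {set V}) : family :=
  fun t' => if t' == s then Some S else F t'.

(* The memory of the algorithm: st i tau t' is S^{i,t'}_tau. *)
Definition state : Type := nat -> R -> family.

Definition accepts (tau : R) (S : {set V}) (x : V) : bool :=
  (tau <= marginal f S x) && (#|S| < k)%N.

Definition backward_step (tau : R) (BF : {set V} * family) (s : nat) :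
    {set V} * family :=
  let: (B, F) := BF in
  if accepts tau B (v s)
  then (v s |: B, store F s (v s |: B))
  else (B, F).

(* If v_t itself is accepted, the initial empty set stored at index t is
   overwritten by {v_t}. *)
Definition backward_pass (tau : R) (t : nat) : family :=
  (foldl (backward_step tau) (set0, store empty_family t set0)
     (rev (index_iota (t - W').+1 t.+1))).2.

Definition forward_update (tau : R) (x : V) (S : {set V}) : {set V} :=
  if accepts tau S x then x |: S else S.

(* The truncated subtraction accounts for the maximum with 0. *)
Definition first_subwindow (t : nat) : nat := ceildiv (t.+1 - W) W'.

Definition init_state : state := fun i tau =>
  if (i == 0%N) && (tau \in thresholds 0)
  then store empty_family 0 set0 else empty_family.

Definition create_families (t : nat) (st : state) : state := fun i tau =>
  if [&& (0 < i)%N, t == (i * W')%N & tau \in thresholds i]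
  then backward_pass tau t else st i tau.

Definition update_families (t : nat) (st : state) : state := fun i tau =>
  if (first_subwindow t <= i < ceildiv t W')%N && (tau \in thresholds i)
  then fun t' => omap (forward_update tau (v t)) (st i tau t')
  else st i tau.

Fixpoint run (t : nat) : state :=
  if t is s.+1 then update_families t (create_families t (run s))
  else init_state.

(* All indices in use at time t are at most t, so this is the set with minimum
   index among those contained in the active window, if there is one. *)
Definition selected (t : nat) (tau : R) : option {set V} :=
  ohead [seq S : {set V} <- pmap (run t (first_subwindow t) tau) (iota 0 t.+1)
           | S \subset active_window v W t].

(* [None] if for some threshold there is no set to select. The start value 0
   is harmless for nonnegative [f], as the list of thresholds is nonempty. *)
Definition bidirectional_alg (t : nat) : option R :=
  let C := [seq selected t tau | tau <- thresholds (first_subwindow t)] in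
  if all isSome C then Some (\big[Num.max/0]_(S <- pmap id C) f S) else None.

End BidirectionalAlg.

(* Main.v *)
Require Import Defs.
From HB Require Import structures.
From mathcomp Require Import all_boot all_order all_algebra.
From mathcomp Require Import reals exp.
From mathcomp Require Import zify lra.

Set Implicit Arguments.
Unset Strict Implicit.
Unset Printing Implicit Defensive.

Import Order.TTheory GRing.Theory Num.Theory.
Local Open Scope ring_scope.

(* For a fixed threshold tau, consider the selected set S of the sub-window in
   which the active window starts. Each of its elements had marginal value at
   least tau when it was added, so |S| = k forces f(S) >= k tau. If |S| < k,
   then every active element outside S was rejected by a subset of S: those
   older than the index of S because otherwise a smaller index would have been
   stored, and selected, since its set also lies in the active window. By
   submodularity OPT <= f(S) + k tau. The reference element of the sub-window
   is active, so the grid of thresholds contains some tau with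
   OPT / (2 (1 + eps)) < k tau <= OPT / 2, and either case gives the bound. *)

(** * Submodularity bounds on unions and on the optimum *)

Section SubmodularBounds.
Context {R : realType} {V : finType} (f : {set V} -> R).
Hypotheses (f_ge0 : forall S, 0 <= f S) (f_mono : monotone_setfun f)
  (f_submod : submodular f).
Implicit Types (S T A O : {set V}) (x : V) (c : R).

Lemma marginal_in S x : x \in S -> marginal f S x = 0.
Proof. by move=> xS; rewrite /marginal (setUidPr _) ?subrr // sub1set. Qed.

(** Submodularity is assumed only for [x] outside [T]; inside [T] the marginal is 0, which is where
    [0 < c] enters. *)
Lemma marginal_ltS S T x c :
  0 < c -> S \subset T -> marginal f S x < c -> marginal f T x < c.
Proof.
move=> c_gt0 ST lt_c; have [xT|xT] := boolP (x \in T).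
  by rewrite marginal_in.
exact: le_lt_trans (f_submod ST xT) lt_c.
Qed.

(** When the elements of [O] join [S] one at a time, submodularity bounds each increment by the
    marginal over [S] alone. *)
Lemma setU_le_marginal S O c : 0 <= c ->
  {in O, forall x, marginal f S x <= c} -> f (S :|: O) <= f S + #|O|%:R * c.
Proof.
move=> c_ge0; move: {2}#|O| (erefl #|O|) => n.
elim: n O => [|n IHn] O cardO leO.
  by rewrite (cards0_eq cardO) setU0 cards0 mul0r addr0.
have [x xO] : exists x, x \in O by apply/card_gt0P; rewrite cardO.
have cardO' : #|O :\ x| = n by move: cardO; rewrite (cardsD1 x) xO => -[].
have IH := IHn _ cardO' (fun y yO' => leO y (subsetP (subD1set O x) y yO')).
have step : marginal f (S :|: O :\ x) x <= c.
  have [xT|xT] := boolP (x \in S :|: O :\ x); first by rewrite marginal_in.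
  exact: le_trans (f_submod (subsetUl _ _) xT) (leO x xO).
have eqU : x |: (S :|: O :\ x) = S :|: O by rewrite setUCA setD1K.
move: step IH; rewrite /marginal eqU cardO' cardO -natr1 mulrDl mul1r; lra.
Qed.

Lemma opt_sup k A : exists O, [/\ O \subset A, (#|O| <= k)%N & opt f k A = f O].
Proof.
rewrite /opt; elim/big_ind: _.
- by exists set0; rewrite sub0set cards0.
- move=> _ _ [O1 [sO1 cO1 ->]] [O2 [sO2 cO2 ->]].
  by rewrite /Num.max; case: ifP => _; [exists O2 | exists O1].
- by move=> O /andP[sO cO]; exists O.
Qed.

Lemma le_opt k A S : S \subset A -> (#|S| <= k)%N -> f S <= opt f k A.
Proof. by move=> SA Sk; apply: le_bigmax_cond; apply/andP. Qed.

Lemma le_max_singleton x : f [set x] <= max_singleton f.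
Proof. exact: le_bigmax. Qed.

(** As [f set0] may be positive, [k] elements only give the bound (k + 1) Delta, which [0 < k] turns
    into 2 k Delta. This puts the optimum below the top of the threshold grid. *)
Lemma opt_le_max_singleton k A x : (0 < k)%N ->
  opt f k A <= (2 * k)%:R * max_singleton f.
Proof.
move=> k_gt0; have [O [_ cO ->]] := opt_sup k A.
set D := max_singleton f.
have D_ge0 : 0 <= D := le_trans (f_ge0 _) (le_max_singleton x).
have f0D : f set0 <= D := le_trans (f_mono (sub0set _)) (le_max_singleton x).
have mO : {in O, forall y, marginal f set0 y <= D}.
  move=> y _; rewrite /marginal setU0.
  have := le_max_singleton y; have := f_ge0 set0; rewrite -/D; lra.
have := setU_le_marginal D_ge0 mO; rewrite set0U.
have cD : #|O|%:R * D <= k%:R * D by rewrite ler_wpM2r // ler_nat.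
have kD : D <= k%:R * D by rewrite ler_peMl // ler1n.
rewrite natrM; lra.
Qed.

End SubmodularBounds.

(** * Geometric grids, first matches in lists, attained maxima *)

Lemma exists_geometric_bracket (R : realDomainType) (q a y : R) (m : nat) :
  a <= y -> y < q ^+ m.+1 * a ->
  exists2 j, (j <= m)%N & q ^+ j * a <= y < q ^+ j.+1 * a.
Proof.
move=> ay; elim: m => [|m IHm] ym.
  by exists 0%N; rewrite // ym mul1r ay.
have [/IHm[j jm Hj]|my] := ltP y (q ^+ m.+1 * a).
  by exists j => //; apply: leq_trans jm _.
by exists m.+1; rewrite ?my.
Qed.

Lemma ltr_expn_trunc_log (R : realType) (q y : R) : 1 < q -> 0 < y ->
  y < q ^+ (Num.truncn (ln y / ln q)).+1.
Proof.
move=> q_gt1 y_gt0; have q_gt0 : 0 < q by apply: lt_trans q_gt1.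
rewrite -ltr_ln ?posrE ?exprn_gt0 // lnXn // -[ltRHS]mulr_natl.
by rewrite -ltr_pdivrMr ?ln_gt0 // truncnS_gt.
Qed.

Lemma ohead_filter_pmap_min (T : Type) (P : pred T) (G : nat -> option T) b n :
  (exists2 S, G b = Some S & P S) -> (b < n)%N ->
  exists t S, [/\ ohead [seq S <- pmap G (iota 0 n) | P S] = Some S,
    G t = Some S, P S &
    forall q S', (q < t)%N -> G q = Some S' -> ~~ P S'].
Proof.
move=> [Sb Gb PSb] bn.
have hasb : exists q, oapp P false (G q) by exists b; rewrite Gb.
case: (ex_minnP hasb) => t Pt t_min.
have tb : (t <= b)%N by apply: t_min; rewrite Gb.
have none q : (q < t)%N -> oapp P false (G q) = false.
  by move=> qt; apply/negP => /t_min; rewrite leqNgt qt.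
case Gt : (G t) Pt => [S|//] /= PS.
exists t, S; split=> //; last first.
  by move=> q S' /none Pq Gq; move: Pq; rewrite Gq /= => ->.
have prefix_nil m : (m <= t)%N -> [seq S <- pmap G (iota 0 m) | P S] = [::].
  elim: m => // m IHm mt.
  rewrite -addn1 iotaD add0n pmap_cat filter_cat IHm ?cats0 //=; last lia.
  by have := none m mt; case: (G m) => [S'|] //= ->.
have -> : n = (t + (n - t.+1).+1)%N by lia.
by rewrite iotaD add0n pmap_cat filter_cat prefix_nil //= Gt /= PS.
Qed.

Lemma bigmax_attained (R : realDomainType) (T : eqType) (F : T -> R)
    (s : seq T) :
  s != [::] -> (forall x, 0 <= F x) ->
  exists2 x, x \in s & \big[Num.max/0]_(y <- s) F y = F x.
Proof.
case: s => // x0 s _ F_ge0; elim: s x0 => [|x1 s IHs] x0.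
  by exists x0; rewrite ?mem_head // big_cons big_nil max_l.
rewrite big_cons; have [x xs ->] := IHs x1.
rewrite /Num.max; case: ifP => _; first by exists x; rewrite // inE xs orbT.
by exists x0; rewrite ?mem_head.
Qed.

(** * Rounding up to sub-window boundaries *)

Section CeilDiv.
Implicit Types (a b c i : nat).

Lemma ceildiv_gtE a b i : (0 < b)%N -> (i < ceildiv a b)%N = (i * b < a)%N.
Proof. by move=> b0; rewrite /ceildiv leq_divRL // mulSn; lia. Qed.

Lemma leq_ceildiv a c b : (a <= c)%N -> (ceildiv a b <= ceildiv c b)%N.
Proof. by move=> ac; rewrite /ceildiv leq_div2r // leq_add2r. Qed.

Lemma ceildiv_mulr_ge a b : (0 < b)%N -> (a <= ceildiv a b * b)%N.
Proof. by move=> b0; rewrite leqNgt -ceildiv_gtE // ltnn. Qed.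

Lemma ceildiv_mulr_lt a b : (0 < b)%N -> (ceildiv a b * b < a + b)%N.
Proof. by move=> b0; have := leq_divM (a + b.-1) b; rewrite /ceildiv; lia. Qed.

End CeilDiv.

(** * Stream segments and the position of the active window *)

Section Windows.
Context {V : finType} (v : nat -> V).
Implicit Types (a u t W : nat) (x : V).

Definition segment (a u : nat) : {set V} :=
  [set:: [seq v s | s <- index_iota (maxn 1 a) u.+1]].

Lemma segmentP a u x :
  reflect (exists2 p, (maxn 1 a <= p <= u)%N & x = v p) (x \in segment a u).
Proof.
rewrite inE; apply: (iffP mapP) => -[p Hp ->]; exists p => //;
by move: Hp; rewrite mem_index_iota.
Qed.

Lemma segmentS a a' u u' : (a' <= a)%N -> (u <= u')%N ->
  segment a u \subset segment a' u'.
Proof.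
move=> aa uu; apply/subsetP => _ /segmentP[p Hp ->]; apply/segmentP.
by exists p => //; lia.
Qed.

Lemma active_windowE W t : active_window v W t = segment (t.+1 - W) t.
Proof. by []. Qed.

Context (W W' : nat) (W'_gt0 : (0 < W')%N) (W'_le : (W' <= W)%N).

Lemma first_subwindow_bounds t :
  (t.+1 - W <= first_subwindow W W' t * W' <= t)%N /\
  (first_subwindow W W' t * W' - W' <= t - W)%N.
Proof.
rewrite /first_subwindow; set a := (t.+1 - W)%N.
have [a0|a_gt0] := posnP a.
  by rewrite a0 /ceildiv divn_small; lia.
have := ceildiv_mulr_ge a W'_gt0; have := ceildiv_mulr_lt a W'_gt0.
by rewrite /a in a_gt0 *; lia.
Qed.

Lemma ref_elt_active t : (0 < t)%N ->
  ref_elt W' v (first_subwindow W W' t) \in active_window v W t.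
Proof.
move=> t_gt0; have [/andP[b1 b2] _] := first_subwindow_bounds t.
rewrite active_windowE /ref_elt; case: eqP => [i0|i0]; apply/segmentP.
  by exists 1%N => //; move: b1; rewrite i0; lia.
exists (first_subwindow W W' t * W')%N => //; move: b1 b2 i0 W'_gt0.
by case: (first_subwindow _ _ _) => // i; rewrite mulSn; lia.
Qed.

End Windows.

(** * Invariants of the stored sets for one threshold *)

Section Families.
Context {R : realType} {V : finType} (f : {set V} -> R) (k : nat)
  (v : nat -> V).
Hypotheses (f_ge0 : forall S, 0 <= f S) (f_submod : submodular f).
Context (tau : R) (tau_gt0 : 0 < tau).
Implicit Types (S T B : {set V}) (x : V) (F G : @Defs.family V).

(** The guard makes a full set reject everything, so rejection persists as a set grows. *)
Definition rejects S x : Prop := (#|S| < k)%N -> marginal f S x < tau.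

Lemma rejectsS S T x : S \subset T -> rejects S x -> rejects T x.
Proof.
move=> ST rS Tk; apply: (marginal_ltS f_submod tau_gt0 ST (rS _)).
exact: leq_ltn_trans (subset_leq_card ST) Tk.
Qed.

Lemma rejects_in S x : x \in S -> rejects S x.
Proof. by move=> xS _; rewrite marginal_in. Qed.

Lemma not_accepts_rejects S x : ~~ accepts f k tau S x -> rejects S x.
Proof. by move=> nacc Sk; move: nacc; rewrite /accepts Sk andbT -ltNge. Qed.

Definition dense S : Prop := (#|S| <= k)%N /\ #|S|%:R * tau <= f S.

Lemma dense0 : dense set0.
Proof. by split; rewrite cards0 // mul0r. Qed.

Lemma dense_setU1 S x : dense S -> accepts f k tau S x -> dense (x |: S).
Proof.
move=> [_ fS] /andP[le_m Sk].
have cU : (#|x |: S| <= #|S|.+1)%N by rewrite cardsU1; case: (x \notin S); lia.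
split; first exact: leq_trans cU Sk.
have : #|x |: S|%:R * tau <= #|S|.+1%:R * tau by rewrite ler_pM2r // ler_nat.
move: le_m; rewrite /marginal -natr1 mulrDl mul1r; lra.
Qed.

(* The side condition on [p] covers the elements of the set's own lifetime
   ([t' <= p], vacuously) and those met by the backward pass after the set was
   stored and before the next index was stored. *)
Definition tracks (a b u : nat) G : Prop :=
  (exists S, G b = Some S) /\
  forall t' S, G t' = Some S ->
    [/\ (t' <= u)%N, S \subset segment v t' u, dense S &
      forall p, (a <= p <= u)%N ->
        (forall q, (p <= q < t')%N -> G q = None) -> rejects S (v p)].

(** The new element is either added, so that its marginal vanishes, or rejected. The update changes
    no index, hence the side condition on [p] carries over. *)
Lemma tracks_forward a b u G : tracks a b u G ->
  tracks a b u.+1 (fun t' => omap (forward_update f k tau (v u.+1)) (G t')).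
Proof.
set upd := forward_update f k tau (v u.+1) => -[[Sb Gb] trG].
split; first by exists (upd Sb); rewrite Gb.
move=> t' S; case Gt': (G t') => [T|] //= [<-].
have [t'u sT dT rT] := trG _ _ Gt'.
have TupdT : T \subset upd T.
  by rewrite /upd /forward_update; case: ifP => // _; apply: subsetUr.
have sT1 := subset_trans sT (segmentS v (leqnn t') (leqnSn u)).
have v_seg : v u.+1 \in segment v t' u.+1.
  by apply/segmentP; exists u.+1 => //; lia.
split.
- exact: leq_trans t'u _.
- by rewrite /upd /forward_update; case: ifP => _ //;
  rewrite subUset sub1set v_seg.
- by rewrite /upd /forward_update; case: ifP => // acc; apply: dense_setU1.
move=> p /andP[ap pu] none.
have noneG q : (p <= q < t')%N -> G q = None.
  by move=> /none; case: (G q).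
have [pu'|pu'] := leqP p u.
  by apply: rejectsS TupdT (rT p _ noneG); rewrite ap.
have -> : p = u.+1 by lia.
rewrite /upd /forward_update; case: ifPn => [_|].
  by apply: rejects_in; rewrite setU11.
exact: not_accepts_rejects.
Qed.

(** The state once times [b] down to [a] have been read. By the last clause the smallest stored
    index holds the current [B], so whatever [B] rejects next is rejected by that set too. The
    alternative [t' = b] covers the initial empty set, stored before any element is read. *)
Definition backward_inv (a b : nat) (BF : {set V} * @Defs.family V) : Prop :=
  let: (B, F) := BF in
  [/\ dense B, B \subset segment v a b,
      forall p, (a <= p <= b)%N -> rejects B (v p),
      tracks a b b F &
      forall t' S, F t' = Some S ->
        (t' = b \/ a <= t')%N /\
        ((forall q, (a <= q < t')%N -> F q = None) -> S = B)].

Lemma backward_inv_init b :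
  backward_inv b.+1 b (set0, store empty_family b set0).
Proof.
have storeE t' S : store empty_family b set0 t' = Some S ->
    t' = b /\ S = set0 :> {set V}.
  by rewrite /store; case: eqP => // -> [<-].
split; rewrite ?sub0set //; first exact: dense0; first by move=> p; lia.
- split; first by exists set0; rewrite /store eqxx.
  move=> t' S /storeE[-> ->]; split; rewrite ?sub0set //; first exact: dense0.
  by move=> p; lia.
- by move=> t' S /storeE[-> ->]; split; first by left.
Qed.

Lemma backward_inv_step a b BF : (0 < a <= b)%N -> backward_inv a.+1 b BF ->
  backward_inv a b (backward_step f k v tau BF a).
Proof.
case: BF => B F /andP[a_gt0 ab] [dB sB rB [[Sb Fb] trF] lastF].
have va_seg : v a \in segment v a b by apply/segmentP; exists a => //; lia.
have sB' : B \subset segment v a b :=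
  subset_trans sB (segmentS v (leqnSn a) (leqnn b)).
rewrite /backward_step; case: ifPn => [acc|nacc].
- set B' := v a |: B.
  have BB' : B \subset B' := subsetUr _ _.
  have sB'' : B' \subset segment v a b by rewrite subUset sub1set va_seg.
  have rB' p : (a <= p <= b)%N -> rejects B' (v p).
    move=> /andP[ap pb]; move: ap; rewrite leq_eqVlt => /orP[/eqP<-|ap].
      by apply: rejects_in; rewrite setU11.
    by apply: rejectsS BB' (rB p _); rewrite ap.
  have dB' : dense B' by apply: dense_setU1.
  have storea : store F a B' a = Some B' by rewrite /store eqxx.
  split=> //; first split.
  + by rewrite /store; case: eqP => _; [exists B' | exists Sb].
  + move=> t' S; rewrite {1}/store; case: eqP => [-> [<-]|t'a FS].
      by split=> // p /rB'.
    have [t'b sS dS rS] := trF _ _ FS; have [t'_or _] := lastF _ _ FS.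
    (* For [p = a] the side condition would need index [a] to be empty, but it has just been
       filled. *)
    split=> // p /andP[ap pb] none; have [pa|pa] := eqVneq p a.
      by move: (none a); rewrite storea => /(_ ltac:(lia)).
    apply: rS => [|q /[dup] pq /none]; first by lia.
    by rewrite /store; case: eqP.
  + move=> t' S; rewrite {1}/store; case: eqP => [-> [<-]|t'a FS].
      by split; [right|].
    have [t'_or _] := lastF _ _ FS.
    split=> [|none]; first by case: t'_or; [left | right; lia].
    by move: (none a); rewrite storea => /(_ ltac:(lia)).
- have rBa p : (a <= p <= b)%N -> rejects B (v p).
    move=> /andP[ap pb]; move: ap; rewrite leq_eqVlt => /orP[/eqP<-|ap].
      exact: not_accepts_rejects.
    by apply: rB; rewrite ap.
  have lastF' t' S : F t' = Some S ->
      (forall q, (a <= q < t')%N -> F q = None) -> S = B.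
    move=> FS none; have [_ lastS] := lastF _ _ FS.
    by apply: lastS => q aq; apply: none; lia.
  split=> //; first split.
  + by exists Sb.
  + move=> t' S FS; have [t'b sS dS rS] := trF _ _ FS.
    (* For [p = a] the side condition makes [t'] the smallest stored index, so [S] is [B], which has
       just rejected [v a]. *)
    split=> // p /andP[ap pb] none; have [pa|pa] := eqVneq p a;
      last by apply: rS none; lia.
    by rewrite pa in none *; rewrite (lastF' _ _ FS none); apply: rBa; lia.
  + move=> t' S FS; have [t'_or _] := lastF _ _ FS.
    by split; [case: t'_or; [left | right; lia] | exact: lastF' FS].
Qed.

(** Induction on the number of elements read: the oldest one is the last step of the fold. *)
Lemma tracks_backward n b : (n <= b)%N ->
  tracks (b - n).+1 b b (backward_pass f k n v tau b).
Proof.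
rewrite /backward_pass => nb.
suff : backward_inv (b - n).+1 b (foldl (backward_step f k v tau)
    (set0, store empty_family b set0) (rev (index_iota (b - n).+1 b.+1))).
  by case: (foldl _ _ _) => B F [].
elim: n nb => [|n IHn] nb.
  by rewrite subn0 /index_iota subnn; apply: backward_inv_init.
have -> : index_iota (b - n.+1).+1 b.+1 =
    (b - n.+1).+1 :: index_iota (b - n).+1 b.+1.
  have <- : ((b - n.+1).+1 = b - n)%N by lia.
  rewrite /index_iota.
  by have -> : (b.+1 - (b - n.+1).+1 = (b.+1 - (b - n.+1).+2).+1)%N; first lia.
rewrite rev_cons foldl_rcons; apply: backward_inv_step; first by lia.
have -> : ((b - n.+1).+2 = (b - n).+1)%N by lia.
by apply: IHn; lia.
Qed.

End Families.

(** * The threshold grid and the approximation guarantee *)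

Section Guarantee.
Context {R : realType} {V : finType} (f : {set V} -> R) (k W W' : nat)
  (delta : R) (v : nat -> V).
Hypotheses (f_ge0 : forall S, 0 <= f S) (f_mono : monotone_setfun f)
  (f_submod : submodular f) (f_pos : forall x, 0 < f [set x])
  (k_gt0 : (0 < k)%N) (W'_gt0 : (0 < W')%N) (W'_le : (W' <= W)%N)
  (delta_gt0 : 0 < delta).
Implicit Types (t i : nat) (tau : R).

Local Notation T := (thresholds f k W' delta v).
Local Notation st := (run f k W W' delta v).

Lemma thresholds_gt0 i tau : tau \in T i -> 0 < tau.
Proof.
case/mapP => j _ ->; rewrite divr_gt0 ?mulr_gt0 ?exprn_gt0 ?f_pos //.
  exact: addr_gt0.
by rewrite ltr0n muln_gt0 k_gt0.
Qed.

(** The first relevant sub-window never moves back in time, so a family still relevant at [t] has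
    received every update since its creation. *)
Lemma run_tracks i tau t : tau \in T i ->
  (i * W' <= t)%N -> (first_subwindow W W' t <= i)%N ->
  tracks f k v tau (i * W' - W').+1 (i * W') t (st t i tau).
Proof.
move=> Ti; have tau_gt0 := thresholds_gt0 Ti.
elim: t => [|t IHt] it fi.
  have i0 : i = 0%N.
    by move: it; rewrite leqn0 muln_eq0 => /orP[/eqP //|/eqP]; lia.
  rewrite i0 mul0n /= /init_state eqxx -i0 Ti /=; rewrite i0.
  split; first by exists set0; rewrite /store eqxx.
  move=> t' S; rewrite /store; case: eqP => // -> [<-].
  by split; rewrite ?sub0set //; [exact: dense0 | move=> p; lia].
rewrite /= /update_families fi Ti andbT /= ceildiv_gtE // /create_families.
move: it; rewrite leq_eqVlt => /orP[/eqP it|it].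
  (* At the time of creation the strict bound on [i] excludes a forward update, so the family is
     exactly the result of the backward pass. *)
  rewrite it ltnn eqxx Ti andbT; have -> : (0 < i)%N by case: (i) it.
  by rewrite /=; apply: tracks_backward => //; move: it; case: (i) => // j; nia.
rewrite it (gtn_eqF it) andbF; apply: tracks_forward => //; apply: IHt => //.
by apply: leq_trans (leq_ceildiv _ _) fi; lia.
Qed.

Lemma selected_spec t tau : tau \in T (first_subwindow W W' t) ->
  exists S, [/\ selected f k W W' delta v t tau = Some S,
    S \subset active_window v W t, (#|S| <= k)%N &
    f S < k%:R * tau -> opt f k (active_window v W t) <= f S + k%:R * tau].
Proof.
move=> Ti; have tau_gt0 := thresholds_gt0 Ti.
have [/andP[b1 b2] b3] := first_subwindow_bounds W'_gt0 W'_le t.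
have [[Sb Gb] trG] := run_tracks Ti b2 (leqnn _).
set i := first_subwindow W W' t in Ti b1 b2 b3 Gb trG *.
have [_ sSb _ _] := trG _ _ Gb.
have sub_active q (S : {set V}) : (t.+1 - W <= q)%N ->
    S \subset segment v q t -> S \subset active_window v W t.
  by move=> Wq sS; rewrite active_windowE;
    apply: subset_trans sS (segmentS v Wq (leqnn t)).
(* Index [i * W'] is always created and holds only elements from that time on, all active, so the
   selection cannot fail. *)
have base : exists2 S : {set V},
    st t i tau (i * W')%N = Some S & S \subset active_window v W t.
  by exists Sb => //; apply: sub_active sSb.
have [t' [S [selS Gt' SA t'_min]]] := ohead_filter_pmap_min (n := t.+1) base b2.
have [_ _ [Sk fS] rS] := trG _ _ Gt'.
exists S; split=> // fSlt.
have {}Sk : (#|S| < k)%N.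
  rewrite ltn_neqAle Sk andbT; apply/eqP => cS.
  by move: fS; rewrite cS leNgt fSlt.
have rej : {in active_window v W t, forall x, marginal f S x <= tau}.
  move=> _ /segmentP[p Hp ->]; apply/ltW/rS => //; first by lia.
  move=> q /andP[pq qt']; case Gq: (st t i tau q) => [S'|//].
  have [_ sS' _ _] := trG _ _ Gq.
  by case/negP: (t'_min _ _ qt' Gq); apply: sub_active sS'; lia.
have [O [OA Ok ->]] := opt_sup f k (active_window v W t).
have := setU_le_marginal f_submod (ltW tau_gt0) (sub_in1 (subsetP OA) rej).
have Otau : #|O|%:R * tau <= k%:R * tau by rewrite ler_pM2r // ler_nat.
have := f_mono (subsetUr S O); lra.
Qed.

(** Scaled by 2 k, the grid starts at the value of the active reference element, at most [OPT], and
    one step past its end it exceeds 2 k Delta, hence [OPT]. *)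
Lemma exists_threshold t : (0 < t)%N ->
  let OPT := opt f k (active_window v W t) in
  exists2 tau, tau \in T (first_subwindow W W' t) &
    2 * k%:R * tau <= OPT < (1 + delta) * (2 * k%:R * tau).
Proof.
move=> t_gt0 OPT; set i := first_subwindow W W' t; set r := ref_elt W' v i.
have r_le : f [set r] <= OPT.
  by apply: le_opt; rewrite ?cards1 // sub1set ref_elt_active.
set y := (2 * k)%:R * max_singleton f.
have OPTy : OPT <= y by apply: opt_le_max_singleton.
have r_gt0 : 0 < f [set r] by [].
have y_gt0 : 0 < y by apply: lt_le_trans OPTy; apply: lt_le_trans r_le.
have k2_gt0 : 0 < (2 * k)%:R :> R by rewrite ltr0n muln_gt0 k_gt0.
have delta1 : 1 < 1 + delta by rewrite ltrDl.
have upper :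
    OPT < (1 + delta) ^+ (num_thresholds f k W' delta v i).+1 * f [set r].
  apply: le_lt_trans OPTy _; rewrite -ltr_pdivrMr //.
  by apply: ltr_expn_trunc_log => //; apply: divr_gt0.
have [j jm /andP[lo hi]] := exists_geometric_bracket r_le upper.
exists ((1 + delta) ^+ j * f [set r] / (2 * k)%:R).
  by apply/mapP; exists j => //; rewrite mem_iota.
have -> : 2 * k%:R * ((1 + delta) ^+ j * f [set r] / (2 * k)%:R) =
          (1 + delta) ^+ j * f [set r].
  by rewrite -natrM mulrC divfK // gt_eqF.
by rewrite lo mulrA -exprS.
Qed.

Lemma bidirectional_algP t : exists S tau,
  [/\ bidirectional_alg f k W W' delta v t = Some (f S),
    tau \in T (first_subwindow W W' t),
    selected f k W W' delta v t tau = Some S &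
    forall tau' S', tau' \in T (first_subwindow W W' t) ->
      selected f k W W' delta v t tau' = Some S' -> f S' <= f S].
Proof.
set i := first_subwindow W W' t; set sel := selected f k W W' delta v t.
have sel_some tau : tau \in T i -> exists S, sel tau = Some S.
  by move=> /selected_spec[S [selS _ _ _]]; exists S.
set C := [seq sel tau | tau <- T i].
have memC S : (S \in pmap id C) = (Some S \in C).
  by rewrite mem_pmap map_id.
have C_neq0 : pmap id C != [::].
  have T0 : (T i) = head 0 (T i) :: behead (T i) by [].
  have [|S S0] := sel_some (head 0 (T i)); first by rewrite T0 mem_head.
  have : S \in pmap id C by rewrite memC -S0 /C T0 mem_head.
  by case: (pmap id C).
have [S SC maxE] := bigmax_attained C_neq0 f_ge0.
have [tau Ttau selS] : exists2 tau, tau \in T i & Some S = sel tau.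
  by apply/mapP; rewrite -memC.
exists S, tau; split=> //; last first.
  move=> tau' S' Ttau' selS'; rewrite -maxE; apply: (le_bigmax_seq 0) => //.
  by rewrite memC -selS'; apply: map_f.
rewrite /bidirectional_alg -/i -/sel -/C maxE.
case: allP => // -[] _ /mapP[tau' /sel_some[S' selS'] ->].
by rewrite selS'.
Qed.

End Guarantee.

Theorem theorem3 (R : realType) (V : finType) (f : {set V} -> R)
    (k W W' : nat) (eps : R) (v : nat -> V)
    (f_ge0 : forall S : {set V}, 0 <= f S)
    (f_mono : monotone_setfun f)
    (f_submod : submodular f)
    (f_pos : forall x : V, 0 < f [set x])
    (k_ge1 : (1 <= k)%N)
    (W'_range : (1 <= W' <= W)%N)
    (eps_range : 0 < eps < 1)
    (t : nat) (t_ge1 : (1 <= t)%N) :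
  exists S : {set V},
    [/\ bidirectional_alg f k W W' eps v t = Some (f S),
        S \subset active_window v W t,
        (#|S| <= k)%N
      & (1 / 2 - eps) * opt f k (active_window v W t) <= f S].
Proof.
have /andP[W'_gt0 W'_le] := W'_range; have /andP[eps_gt0 eps_lt1] := eps_range.
have [S [tau [algS Ttau selS S_max]]] :=
  bidirectional_algP v f_ge0 f_mono f_submod f_pos k_ge1 W'_gt0 W'_le eps_gt0 t.
have spec tau' := @selected_spec _ _ _ _ _ _ _ v f_ge0 f_mono f_submod f_pos
  k_ge1 W'_gt0 W'_le eps_gt0 t tau'.
have [S1 [selS1 SA Sk _]] := spec _ Ttau.
have eqS1 : S1 = S by move: selS1; rewrite selS => -[].
rewrite {}eqS1 {selS1} in SA Sk.
exists S; split=> //.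
have [sigma Tsigma /andP[lo hi]] := exists_threshold v f_ge0 f_mono f_submod
  f_pos k_ge1 W'_gt0 W'_le eps_gt0 t_ge1.
have [S' [selS' _ _ fS']] := spec _ Tsigma.
have S'S := S_max _ _ Tsigma selS'.
move: lo hi fS'; rewrite -mulrA.
set OPT := opt _ _ _; set c := k%:R * sigma => lo hi fS'.
have OPT_ge0 : 0 <= OPT.
  by rewrite /OPT; have [O [_ _ ->]] := opt_sup f k (active_window v W t).
have epsOPT : 0 <= eps * OPT by rewrite mulr_ge0 // ltW.
(* Below [c], [OPT <= f S' + c] and [2 * c <= OPT] give half of [OPT]. *)
have [lt_c|ge_c] := ltP (f S') c.
  have := fS' lt_c; lra.
(* Bounding 2 eps c by eps OPT in [hi] gives (1 - eps) OPT < 2 c. *)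
have : (1 / 2 - eps) * OPT <= c.
  have : eps * (2 * c) <= eps * OPT by rewrite ler_pM2l.
  lra.
lra.
Qed.
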